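(* Let $\mathcal{A}=E\cup B\subset\mathbb{Z}^d$ with $E=\{\mathbf{a}_1,\ldots,\mathbf{a}_r\}$, $B=\{\mathbf{b}_1,\ldots,\mathbf{b}_s\}$, be such that no nontrivial $\mathbb{N}$-linear combination of the elements of $\mathcal{A}$ is zero and $\mathrm{pos}(\mathcal{A})=\mathrm{pos}(E)$. Let $S$ be the semigroup generated by $\mathcal{A}$, let $\prec$ be an $\mathcal{A}$-graded reverse lexicographical monomial order on $\Bbbk[\mathbf{Y},\mathbf{Z}]$ with $Y_i\prec Z_j$ for all $i,j$, and let $\mathcal{Q}=\{\mathbf{u}\in\mathbb{N}^s\mid \mathbf{Z}^{\mathbf{u}}\notin \mathrm{in}_\prec(I_\mathcal{A})\}$. Let $\iota:\mathbb{N}^s\hookrightarrow\mathbb{N}^{r+s}$, $\mathbf{u}\mapsto(0,\mathbf{u})$. Then the restriction of $\deg_\mathcal{A}\circ\iota$ to $\mathcal{Q}$, i.e. the map $\mathbf{u}\mapsto \sum_{j=1}^s u_j\mathbf{b}_j$, is a bijection from $\mathcal{Q}$ onto the Apéry set $\mathrm{Ap}(S,E)$.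
   Context: $\mathbb{N}$ denotes the nonnegative integers and $\Bbbk$ is a field. $\mathcal{A}=\{\mathbf{a}_1,\ldots,\mathbf{a}_n\}\subset\mathbb{Z}^d$ is a finite set such that $\sum u_i\mathbf{a}_i=0$ with $u_i\in\mathbb{N}$ implies all $u_i=0$. $S=\mathbb{N}\mathbf{a}_1+\cdots+\mathbb{N}\mathbf{a}_n$. The polyhedral cone is $\mathrm{pos}(\mathcal{A})=\{\sum\lambda_i\mathbf{a}_i\mid\lambda_i\in\mathbb{Q}_{\ge0}\}$. The elements are labelled so that $\mathrm{pos}(\mathcal{A})=\mathrm{pos}(E)$ with $E=\{\mathbf{a}_1,\ldots,\mathbf{a}_r\}$, and $\mathbf{b}_j=\mathbf{a}_{r+j}$, $j=1,\ldots,s=n-r$, $B=\{\mathbf{b}_1,\ldots,\mathbf{b}_s\}$. $\Bbbk[\mathbf{Y},\mathbf{Z}]=\Bbbk[Y_1,\ldots,Y_r,Z_1,\ldots,Z_s]$. For $(\mathbf{v},\mathbf{u})\in\mathbb{N}^r\times\mathbb{N}^s$, $\deg_\mathcal{A}(\mathbf{v},\mathbf{u})=\sum_i v_i\mathbf{a}_i+\sum_j u_j\mathbf{b}_j\in S$. $\Bbbk[S]=\bigoplus_{\mathbf{a}\in S}\Bbbk\chi^{\mathbf{a}}$ is the semigroup algebra, and $I_\mathcal{A}$ is the kernel of the $\Bbbk$-algebra map $\Bbbk[\mathbf{Y},\mathbf{Z}]\to\Bbbk[S]$, $\mathbf{Y}^{\mathbf{v}}\mathbf{Z}^{\mathbf{u}}\mapsto\chi^{\deg_\mathcal{A}(\mathbf{v},\mathbf{u})}$.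 $\mathcal{A}$-graded reverse lexicographical order $\prec$ with $Y_i\prec Z_j$: fix a total order on the variables in which every $Y_i$ is smaller than every $Z_j$. Then $\mathbf{Y}^{\mathbf{v}'}\mathbf{Z}^{\mathbf{u}'}\prec\mathbf{Y}^{\mathbf{v}}\mathbf{Z}^{\mathbf{u}}$ iff either the leftmost nonzero entry of $\deg_\mathcal{A}(\mathbf{v},\mathbf{u})-\deg_\mathcal{A}(\mathbf{v}',\mathbf{u}')\in\mathbb{Z}^d$ is positive, or the two degrees are equal and $\mathbf{Y}^{\mathbf{v}'}\mathbf{Z}^{\mathbf{u}'}\prec_{revlex}\mathbf{Y}^{\mathbf{v}}\mathbf{Z}^{\mathbf{u}}$, meaning that the smallest variable whose exponents in the two monomials differ has larger exponent in $\mathbf{Y}^{\mathbf{v}'}\mathbf{Z}^{\mathbf{u}'}$. $\mathrm{in}_\prec(I_\mathcal{A})$ is the ideal generated by the $\prec$-leading (largest) monomials of the nonzero elements of $I_\mathcal{A}$. $\mathrm{Ap}(S,E)=\{\mathbf{a}\in S\mid \mathbf{a}-\mathbf{e}\notin S\ \text{for all }\mathbf{e}\in E\}$. *)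

(* Defs.v *)
From HB Require Import structures.
From mathcomp Require Import all_boot all_order all_algebra.
From mathcomp Require Import boolp classical_sets functions.
(* The notations ['X_{1..n}] and [{mpoly R[n]}] of [monalg] denote other types
   than those of [mpoly]. *)
From mathcomp Require Import -(notations) monalg.
From mathcomp Require Import mpoly.

Set Implicit Arguments.
Unset Strict Implicit.
Unset Printing Implicit Defensive.

Import Order.TTheory GRing.Theory Num.Theory.

Local Open Scope classical_set_scope.
Local Open Scope ring_scope.

Definition adeg d n (a : 'I_n -> 'rV[int]_d) (m : 'X_{1..n}) : 'rV[int]_d :=
  \sum_(i < n) a i *+ m i.

Definition pointed d n (a : 'I_n -> 'rV[int]_d) : Prop :=
  forall u : 'I_n -> nat, \sum_(i < n) a i *+ u i = 0 -> forall i, u i = 0%N.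

Definition pos d n (a : 'I_n -> 'rV[int]_d) : set 'rV[rat]_d :=
  [set x | exists2 l : 'I_n -> rat,
     forall i, 0 <= l i & x = \sum_(i < n) l i *: map_mx intr (a i)].

Definition affine_semigroup d n (a : 'I_n -> 'rV[int]_d) : set 'rV[int]_d :=
  range (adeg a).

Definition apery d (S E : set 'rV[int]_d) : set 'rV[int]_d :=
  [set x | S x /\ forall e, E e -> ~ S (x - e)].

(* The semigroup [affine_semigroup a] as a type. The proof of [pointed a] does
   not occur in the carrier: it only provides the axiom [unitm] of [monomType],
   which makes [{malg k[semigroup_of a_pt]}] the semigroup algebra. *)
Definition semigroup_of d n (a : 'I_n -> 'rV[int]_d) of pointed a : Type :=
  set_type (affine_semigroup a).

Section SemigroupAlgebra.
Variables (d n : nat) (a : 'I_n -> 'rV[int]_d) (a_pt : pointed a).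

Local Notation S := (semigroup_of a_pt).
Local Notation "{ 'malg' k [ K ] }" := (@monalg.malg K k) : type_scope.
Local Notation "<< x >>" := (monalg.mkmalgU x 1) : ring_scope.

HB.instance Definition _ := Choice.copy S (set_type (affine_semigroup a)).

Lemma adeg0 : adeg a 0%MM = 0.
Proof. by rewrite /adeg big1 // => i _; rewrite mnm0E. Qed.

Lemma adegD m1 m2 : adeg a (m1 + m2)%MM = adeg a m1 + adeg a m2.
Proof.
by rewrite /adeg -big_split /=; apply: eq_bigr => i _; rewrite mnmDE mulrnDr.
Qed.

Lemma adeg_in m : adeg a m \in affine_semigroup a.
Proof. by apply/mem_set; exists m. Qed.

Definition sdeg (m : 'X_{1..n}) : S :=
  exist (fun x => x \in affine_semigroup a) (adeg a m) (adeg_in m).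

Lemma sadd_in (x y : S) : sval x + sval y \in affine_semigroup a.
Proof.
have [m1 _ <-] := set_mem (svalP x); have [m2 _ <-] := set_mem (svalP y).
by rewrite -adegD adeg_in.
Qed.

Definition szero : S := sdeg 0%MM.

Definition sadd (x y : S) : S :=
  exist (fun z => z \in affine_semigroup a) (sval x + sval y) (sadd_in x y).

Lemma svalS_inj (x y : S) : sval x = sval y -> x = y.
Proof. by move=> h; apply/val_inj. Qed.

Lemma saddA : associative sadd.
Proof. by move=> x y z; apply: svalS_inj; rewrite /= addrA. Qed.

Lemma saddC : commutative sadd.
Proof. by move=> x y; apply: svalS_inj; rewrite /= addrC. Qed.

Lemma sadd0 : left_id szero sadd.
Proof. by move=> x; apply: svalS_inj; rewrite /= adeg0 add0r. Qed.

Lemma sadd0r : right_id szero sadd.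
Proof. by move=> x; rewrite saddC sadd0. Qed.

Lemma sadd_unit x y : sadd x y = szero -> x = szero /\ y = szero.
Proof.
have [m1 _ Ex] := set_mem (svalP x); have [m2 _ Ey] := set_mem (svalP y).
move=> /(congr1 sval) /=.
rewrite -Ex -Ey -adegD adeg0 => /a_pt m0.
have [z1 z2] : m1 = 0%MM /\ m2 = 0%MM.
  split; apply/mnmP => i; move: (m0 i); rewrite mnmDE mnm0E => /eqP;
  by rewrite addn_eq0 => /andP[/eqP + /eqP].
by split; apply: svalS_inj => /=; rewrite -?Ex -?Ey ?z1 ?z2.
Qed.

HB.instance Definition _ :=
  monalg.Choice_isMonomialDef.Build S saddA sadd0 sadd0r sadd_unit.
HB.instance Definition _ :=
  monalg.MonomialDef_isConomialDef.Build S saddC.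

Variable k : fieldType.

Definition toric_map : {mpoly k[n]} -> {malg k[S]} :=
  mmap (GRing.in_alg {malg k[S]}) (fun i => << sdeg U_(i) >>).

HB.instance Definition _ := GRing.RMorphism.on toric_map.

Lemma toric_map_monomial m : toric_map 'X_[m] = << sdeg m >>.
Proof.
rewrite /toric_map mmapX /mmap1 [in RHS](multinomUE_id m).
have chiD m1 m2 : << sdeg (m1 + m2)%MM >> = << sdeg m1 >> * << sdeg m2 >>
    :> {malg k[S]}.
  rewrite monalg.malgM_def monalg.fgmulUU mulr1; congr << _ >>.
  by apply: svalS_inj; rewrite /= adegD.
have chi0 : << sdeg 0%MM >> = 1 :> {malg k[S]} by [].
rewrite (big_morph (fun m => << sdeg m >> : {malg k[S]}) chiD chi0).
apply: eq_bigr => i _; elim: (m i) => [|e IHe]; first by rewrite expr0 mulm0n.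
by rewrite exprS IHe mulmS chiD.
Qed.

Lemma toric_map_scale : scalable toric_map.
Proof. by move=> c p; rewrite /toric_map mmapZ mulr_algl. Qed.

HB.instance Definition _ :=
  GRing.isScalable.Build k {mpoly k[n]} {malg k[S]} *:%R toric_map
    toric_map_scale.

Definition toric_ideal : set {mpoly k[n]} := [set p | toric_map p = 0].

End SemigroupAlgebra.

Arguments toric_map {d n a} a_pt k _.
Arguments toric_ideal {d n a} a_pt k _.

Section MonomialOrder.
Variables (d n : nat) (a : 'I_n -> 'rV[int]_d) (vle : rel 'I_n).

Definition lex_pos (x : 'rV[int]_d) : bool :=
  [exists i : 'I_d, (0 < x 0 i) && [forall j : 'I_d, (j < i)%N ==> (x 0 j == 0)]].

(* [revlex m' m] and [agrevlex m' m] read "m' is smaller than m"; [vle] is the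
   non-strict order on the variables. *)
Definition revlex (m' m : 'X_{1..n}) : bool :=
  [exists i : 'I_n, (m i < m' i)%N &&
     [forall j : 'I_n, (j != i) && vle j i ==> (m j == m' j)]].

Definition agrevlex (m' m : 'X_{1..n}) : bool :=
  lex_pos (adeg a m - adeg a m') ||
  ((adeg a m == adeg a m') && revlex m' m).

End MonomialOrder.

Section InitialIdeal.
Variables (n : nat) (k : fieldType).

Definition is_lead (prec : rel 'X_{1..n}) (p : {mpoly k[n]}) (m : 'X_{1..n}) :=
  m \in msupp p /\ forall m', m' \in msupp p -> m' != m -> prec m' m.

Definition is_ideal (J : set {mpoly k[n]}) : Prop :=
  [/\ J 0, forall p q, J p -> J q -> J (p + q)
    & forall c p, J p -> J (c * p)].

Definition ideal_gen (G : set {mpoly k[n]}) : set {mpoly k[n]} :=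
  smallest is_ideal G.

Definition initial_ideal (prec : rel 'X_{1..n}) (I : set {mpoly k[n]}) :=
  ideal_gen
    [set 'X_[m] | m in [set m | exists f, [/\ I f, f != 0 & is_lead prec f m]]].

End InitialIdeal.

(* Among the variables indexed by ['I_(r + s)], [Y_i] is ['X_(lshift s i)] and
   [Z_j] is ['X_(rshift r j)]. *)
Definition iotaZ r s (u : 'X_{1..s}) : 'X_{1..r + s} :=
  [multinom (match fintype.split i with inl _ => 0%N | inr j => u j end) | i < r + s].

Lemma adeg_iotaZ d r s (a : 'I_(r + s) -> 'rV[int]_d) (u : 'X_{1..s}) :
  adeg a (iotaZ r u) = \sum_(j < s) a (rshift r j) *+ u j.
Proof.
rewrite /adeg big_split_ord /= big1 ?add0r => [|i _].
  by apply: eq_bigr => j _; rewrite mnmE -[rshift r j]/(unsplit (inr j)) unsplitK.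
by rewrite mnmE -[lshift s i]/(unsplit (inl i)) unsplitK.
Qed.

Definition standardZ (k : fieldType) r s (prec : rel 'X_{1..r + s})
    (I : set {mpoly k[r + s]}) : set 'X_{1..s} :=
  [set u | ~ initial_ideal prec I 'X_[iotaZ r u]].

(* Main.v *)
(* Let u be standard. A factorization deg u = a_i + deg m with a_i in E makes
   Z^u - Y_i X^m an element of the toric ideal; the smallest variable where its
   two terms differ is some Y, absent from Z^u, so Z^u is the leading term, a
   contradiction: deg u is in the Apery set. If two standard u's had the same
   degree, the larger would lead their binomial: the map is injective.
   Conversely, since the grading is pointed, Dickson's lemma forbids infinite
   descent in a fiber of deg, so the fiber of an Apery element has a
   revlex-minimal monomial; it involves no Y. Every leading term of an element
   of the toric ideal shares its degree with another, smaller term, so no such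
   leading term divides a minimal monomial, which is therefore standard. *)
Require Import Defs.
From HB Require Import structures.
From mathcomp Require Import all_boot all_order all_algebra.
From mathcomp Require Import boolp classical_sets functions.
From mathcomp Require Import -(notations) monalg.
From mathcomp Require Import mpoly.

Set Implicit Arguments.
Unset Strict Implicit.
Unset Printing Implicit Defensive.

Import Order.TTheory GRing.Theory Num.Theory.

Local Open Scope classical_set_scope.
Local Open Scope ring_scope.

(** Every tail of [u] attains its minimum, since [nat] is well-ordered. Taking at each stage an
    index of the minimum over the tail just after the previous one gives increasing indices, and
    these minima of shrinking tails cannot decrease. *)
Lemma nondecreasing_subseq (u : nat -> nat) :
  exists phi : nat -> nat, {homo phi : i j / (i < j)%N} /\
    {homo u \o phi : i j / (i <= j)%N}.
Proof.
have tail_min k : exists i, (k <= i)%N /\ forall j, (k <= j)%N -> (u i <= u j)%N.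
  have ex : exists v, `[< exists2 i, (k <= i)%N & u i = v >].
    by exists (u k); apply/asboolP; exists k.
  case: (ex_minnP ex) => v /asboolP[i ki <-] vmin.
  by exists i; split=> // j kj; apply: vmin; apply/asboolP; exists j.
have [g /all_and2[g_ge g_min]] := choice tail_min.
pose phi i := iter i (fun x => g x.+1) (g 0%N).
have phiS i : (phi i < phi i.+1)%N by exact: g_ge.
have phi_lt : {homo phi : i j / (i < j)%N} by move=> i j; apply: (homo_ltn ltn_trans phiS).
exists phi; split=> //; move=> i j; apply: (homo_leq leqnn leq_trans) => {i j}.
by case=> [|i]; apply: g_min => //; exact: ltn_trans (phiS _) (phiS _).
Qed.

(** Extract subsequences one coordinate at a time: refining keeps the coordinates already treated
    monotone. Any two terms of the last subsequence will do. *)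
Lemma dickson (n : nat) (w : nat -> 'X_{1..n}) : exists i j, (i < j)%N /\ (w i <= w j)%MM.
Proof.
have [phi [phi_lt phi_le]] : exists phi : nat -> nat,
    {homo phi : i j / (i < j)%N} /\
    forall c, c \in enum 'I_n -> {homo (fun i => w (phi i) c) : i j / (i <= j)%N}.
  elim: (enum _) => [|c s [phi [phi_lt phi_le]]]; first by exists id; split.
  have [psi [psi_lt psi_le]] := nondecreasing_subseq (fun i => w (phi i) c).
  have psi_le_mono := ltnW_homo psi_lt.
  exists (phi \o psi); split=> [i j /psi_lt/phi_lt //|c'].
  by rewrite inE => /predU1P[-> //|/phi_le c'_le i j /psi_le_mono/c'_le].
exists (phi 0%N), (phi 1%N); split; first exact: phi_lt.
by apply/mnm_lepP => c; apply: (phi_le c); rewrite ?mem_enum.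
Qed.

Lemma adegU d n (a : 'I_n -> 'rV[int]_d) i : adeg a U_(i) = a i.
Proof.
rewrite /adeg (bigD1 i) //= big1 => [|j ji]; first by rewrite mnm1E eqxx addr0.
by rewrite mnm1E eq_sym (negbTE ji).
Qed.

(** The quotient of the two monomials has degree zero, so pointedness makes it trivial. *)
Lemma adeg_le_inj (d n : nat) (a : 'I_n -> 'rV[int]_d) (a_pt : pointed a)
    (m1 m2 : 'X_{1..n}) :
  (m1 <= m2)%MM -> adeg a m1 = adeg a m2 -> m1 = m2.
Proof.
move=> /submK <-; rewrite adegD -[LHS]add0r => /addIr/esym/a_pt m0.
by apply/mnmP => i; rewrite mnmDE m0.
Qed.

Section Revlex.
Variables (n : nat) (vle : rel 'I_n).
Hypotheses (vle_anti : antisymmetric vle) (vle_trans : transitive vle)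
  (vle_total : total vle).
Implicit Types m : 'X_{1..n}.

Lemma revlexP m' m : reflect
  (exists2 i, (m i < m' i)%N & forall j, j != i -> vle j i -> m j = m' j)
  (revlex vle m' m).
Proof.
apply: (iffP existsP) => -[i].
  case/andP=> lti /forallP eqj; exists i => // j ji vji.
  by move: (eqj j); rewrite ji vji => /eqP.
move=> lti eqj; exists i; rewrite lti; apply/forallP => j.
by apply/implyP => /andP[ji vji]; rewrite eqj.
Qed.

Lemma vle_refl : reflexive vle.
Proof. by move=> i; move: (vle_total i i); rewrite orbb. Qed.

Lemma smallest_difference m1 m2 : m1 != m2 ->
  exists2 i, m1 i != m2 i & forall j, m1 j != m2 j -> vle i j.
Proof.
move=> neq; have /existsP[i0 P0] : [exists i, m1 i != m2 i].
  rewrite -negb_forall; apply: contra neq => /forallP eqm.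
  by apply/eqP/mnmP => i; apply/eqP.
by case: (extremumP id vle_refl vle_trans vle_total (P := fun i => m1 i != m2 i) P0) => i; exists i.
Qed.

Lemma revlex_at_smallest m1 m2 i : (m2 i < m1 i)%N ->
  (forall j, m1 j != m2 j -> vle i j) -> revlex vle m1 m2.
Proof.
move=> lti imin; apply/revlexP; exists i => // j ji vji.
case: (eqVneq (m1 j) (m2 j)) => // /imin vij.
by case/eqP: ji; apply: vle_anti; rewrite vji.
Qed.

Lemma revlex_total m1 m2 : m1 != m2 -> revlex vle m1 m2 || revlex vle m2 m1.
Proof.
move=> /smallest_difference[i]; rewrite neq_ltn => lti imin.
apply/orP; case/orP: lti => lti; [right|left]; apply: revlex_at_smallest lti _ => //.
by move=> j; rewrite eq_sym; apply: imin.
Qed.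

Lemma revlex_irr m : revlex vle m m = false.
Proof. by apply/revlexP => -[i]; rewrite ltnn. Qed.

Lemma revlex_trans : transitive (revlex vle).
Proof.
move=> m2 m1 m3 /revlexP[i lti eqi] /revlexP[j ltj eqj]; apply/revlexP.
have [eqij|ij] := eqVneq i j.
  subst j; exists i; first exact: ltn_trans ltj lti.
  by move=> c ci vci; rewrite eqj // eqi.
(* The smaller of the witnesses [i] and [j] serves for the composite: variables strictly below it
   are strictly below the other one too, so both comparisons agree there. *)
have below x y c : x != y -> vle x y -> vle c x -> c != y /\ vle c y.
  move=> xy vxy vcx; split; last exact: vle_trans vcx vxy.
  by apply: contraNneq xy => cy; apply/eqP/vle_anti; rewrite vxy -cy.
case/orP: (vle_total i j) => [vij|vji].
  exists i; first by rewrite eqj.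
  by move=> c ci vci; have [cj vcj] := below _ _ _ ij vij vci; rewrite eqj // eqi.
rewrite eq_sym in ij; exists j; first by rewrite -eqi.
by move=> c cj vcj; have [ci vci] := below _ _ _ ij vji vcj; rewrite eqj // eqi.
Qed.

Lemma revlex_addl m m1 m2 : revlex vle (m + m1)%MM (m + m2)%MM = revlex vle m1 m2.
Proof.
by apply: eq_existsb => i; rewrite !mnmDE ltn_add2l; congr andb;
  apply: eq_forallb => j; rewrite !mnmDE eqn_add2l.
Qed.

Lemma agrevlexE d (a : 'I_n -> 'rV[int]_d) m' m :
  adeg a m = adeg a m' -> agrevlex a vle m' m = revlex vle m' m.
Proof.
move=> eqd; rewrite /agrevlex eqd subrr eqxx /=.
by have -> : lex_pos (0 : 'rV[int]_d) = false
  by apply/existsP => -[i]; rewrite mxE ltxx.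
Qed.

(** [revlex] is not well-founded on all monomials: the powers of a variable descend forever. Inside
    one fiber, distinct monomials never divide each other, so Dickson's lemma excludes an infinite
    descent. *)
Lemma revlex_min_fiber d (a : 'I_n -> 'rV[int]_d) (a_pt : pointed a) m0 :
  exists2 m, adeg a m = adeg a m0 &
    forall m', adeg a m' = adeg a m -> ~~ revlex vle m' m.
Proof.
apply: contrapT => nomin.
pose fiber := {m | adeg a m = adeg a m0}.
have fiberP (x : fiber) : adeg a (sval x) = adeg a m0 by case: x.
have descend (x : fiber) : {y : fiber | revlex vle (sval y) (sval x)}.
  apply: cid; apply: contrapT => nosmaller; apply: nomin.
  exists (sval x); first exact: fiberP.
  move=> m'; rewrite fiberP => m'_deg; apply/negP => lt_m'.
  by apply: nosmaller; exists (exist (fun m => adeg a m = adeg a m0) m' m'_deg).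
have [w [_ w_desc]] := dependent_choice descend (exist (fun m => adeg a m = adeg a m0) m0 erefl).
have w_lt i j : (i < j)%N -> revlex vle (sval (w j)) (sval (w i)).
  have gt_trans y x z : revlex vle y x -> revlex vle z y -> revlex vle z x.
    by move=> yx zy; exact: revlex_trans zy yx.
  by apply: (homo_ltn (f := fun i => sval (w i)) gt_trans w_desc).
have [i [j [ij le_ij]]] := dickson (fun i => sval (w i)).
have := w_lt _ _ ij; rewrite (adeg_le_inj a_pt le_ij) ?revlex_irr //.
by rewrite !fiberP.
Qed.

End Revlex.

(** The polynomials whose support consists of multiples of elements of [G] form an ideal containing
    the generators. *)
Lemma monomial_ideal_dvd (n : nat) (k : fieldType) (G : set 'X_{1..n})
    (p : {mpoly k[n]}) :
  ideal_gen [set 'X_[m] | m in G] p ->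
  forall m, m \in msupp p -> exists2 m1, G m1 & (m1 <= m)%MM.
Proof.
move: p; apply: smallest_sub => [|_ [m1 Gm1 <-] m]; last first.
  by rewrite msuppX mem_seq1 => /eqP ->; exists m1 => //; exact: lepm_refl.
split=> [m|p q Jp Jq m /msuppD_le|c p Jp m /msuppM_le /allpairsP[[m1 m2] /=]].
- by rewrite msupp0.
- by rewrite mem_cat => /orP[/Jp|/Jq].
- case=> _ /Jp[m3 Gm3 le32] ->; exists m3 => //.
  by apply: lepm_trans le32 _; exact: lem_addl.
Qed.

Section ToricIdeal.
Variables (d n : nat) (a : 'I_n -> 'rV[int]_d) (a_pt : pointed a) (k : fieldType).
Implicit Types m : 'X_{1..n}.

Lemma toric_binomial m1 m2 :
  adeg a m1 = adeg a m2 -> toric_ideal a_pt k ('X_[m1] - 'X_[m2]).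
Proof.
move=> eqd; rewrite /toric_ideal /=. rewrite rmorphB /= !toric_map_monomial.
by rewrite (_ : sdeg a_pt m1 = sdeg a_pt m2) ?subrr //; apply: svalS_inj.
Qed.

Lemma toric_map_coef (f : {mpoly k[n]}) m1 :
  monalg.mcoeff (sdeg a_pt m1) (toric_map a_pt k f) =
    \sum_(m <- msupp f) f@_m *+ (adeg a m == adeg a m1).
Proof.
have -> : toric_map a_pt k f = \sum_(m <- msupp f) f@_m *: toric_map a_pt k 'X_[m].
  rewrite [f in LHS]mpolyE (raddf_sum (toric_map a_pt k)).
  by apply: eq_bigr => m _; rewrite /= toric_map_scale.
rewrite (raddf_sum (monalg.mcoeff (sdeg a_pt m1))) /=; apply: eq_bigr => m _.
by rewrite toric_map_monomial monalg.mcoeffZ monalg.mcoeffU mulrnAr mulr1.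
Qed.

(** If [m1] were alone in its degree, its nonzero coefficient would survive as a coefficient of the
    image of [f]. *)
Lemma toric_cancel (f : {mpoly k[n]}) m1 :
  toric_ideal a_pt k f -> m1 \in msupp f ->
  exists m2, [/\ m2 \in msupp f, m2 != m1 & adeg a m2 = adeg a m1].
Proof.
move=> If m1f; apply: contrapT => alone.
have := toric_map_coef f m1; rewrite If monalg.mcoeff0.
rewrite (bigD1_seq m1) ?msupp_uniq //= eqxx big_seq_cond big1 ?addr0.
  by move/esym/eqP; apply/negP; rewrite -mcoeff_msupp.
move=> m /andP[mf neq]; case: eqP => // eqd.
by case: alone; exists m.
Qed.

Lemma binomial_lead (vle : rel 'I_n) m1 m2 :
  adeg a m1 = adeg a m2 -> m1 != m2 -> revlex vle m2 m1 ->
  initial_ideal (agrevlex a vle) (toric_ideal a_pt k) 'X_[m1].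
Proof.
move=> eqd neq lt21; apply: sub_gen_smallest; exists m1 => //.
have suppB m : (m \in msupp ('X_[m1] - 'X_[m2] : {mpoly k[n]})) = (m \in [:: m1; m2]).
  rewrite mcoeff_msupp mcoeffB !mcoeffX !inE ![m == _]eq_sym.
  by case: (eqVneq m1 m) neq => [->|]; case: (eqVneq m2 m) => //= *;
    rewrite ?subr0 ?sub0r ?oppr_eq0 ?oner_eq0 ?eqxx.
exists ('X_[m1] - 'X_[m2]); split; first exact: toric_binomial.
  by apply/eqP => z; move: (suppB m1); rewrite z msupp0 !inE eqxx.
split=> [|m]; first by rewrite suppB !inE eqxx.
by rewrite suppB !inE => /orP[->//|/eqP -> _]; rewrite agrevlexE.
Qed.

End ToricIdeal.

Theorem theorem4 (k : fieldType) (d r s : nat)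
    (a : 'I_(r + s) -> 'rV[int]_d)
    (a_inj : injective a)
    (a_pt : pointed a)
    (posE : pos a = pos (fun i : 'I_r => a (lshift s i)))
    (vle : rel 'I_(r + s))
    (vle_anti : antisymmetric vle)
    (vle_trans : transitive vle)
    (vle_total : total vle)
    (vle_YZ : forall (i : 'I_r) (j : 'I_s), vle (lshift s i) (rshift r j)) :
  set_bij
    (standardZ (agrevlex a vle) (toric_ideal a_pt k))
    (apery (affine_semigroup a) (range (fun i : 'I_r => a (lshift s i))))
    (fun u : 'X_{1..s} => adeg a (iotaZ r u)).
Proof.
have iotaZ_l (u : 'X_{1..s}) i : iotaZ r u (lshift s i) = 0%N.
  by rewrite mnmE -[lshift s i]/(unsplit (inl i)) unsplitK.
have iotaZ_r (u : 'X_{1..s}) j : iotaZ r u (rshift r j) = u j.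
  by rewrite mnmE -[rshift r j]/(unsplit (inr j)) unsplitK.
split.
- move=> u Qu; split=> [|_ [i _ <-] [m _ m_deg]]; first by exists (iotaZ r u).
  pose m' := (U_(lshift s i) + m)%MM.
  have m'i : (0 < m' (lshift s i))%N by rewrite mnmDE mnm1E eqxx.
  have neq : iotaZ r u != m'.
    by apply/eqP => /mnmP/(_ (lshift s i)) eqi; rewrite -eqi iotaZ_l in m'i.
  have eqd : adeg a (iotaZ r u) = adeg a m'.
    by rewrite adegD adegU m_deg addrC subrK.
  apply: Qu; apply: (binomial_lead eqd neq).
  have [v vneq vmin] := smallest_difference vle_trans vle_total neq.
  (* The exponents already differ at $Y_i$, so [v] is at most $Y_i$. Were [v] some $Z_j$, it would
     also be at least $Y_i$, and antisymmetry would identify the two. *)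
  have [i' eqv] : exists i', v = lshift s i'.
    case: (split_ordP v) => [i' ->|j eqv]; first by exists i'.
    have vi : vle v (lshift s i) by apply: vmin; rewrite iotaZ_l neq_ltn m'i.
    exists i; apply: vle_anti; rewrite vi /= eqv; exact: vle_YZ.
  apply: (revlex_at_smallest vle_anti (i := v)) => [|j].
    by move: vneq; rewrite eqv iotaZ_l eq_sym -lt0n.
  by rewrite eq_sym; exact: vmin.
- move=> u1 u2 /set_mem Q1 /set_mem Q2 eqd.
  apply: contrapT => neq.
  have {}neq : iotaZ r u1 != iotaZ r u2.
    by apply/eqP => /mnmP e; apply/neq/mnmP => j; rewrite -!iotaZ_r.
  case/orP: (revlex_total vle_anti vle_trans vle_total neq) => lt12.
  + by apply: Q2; apply: (binomial_lead (esym eqd) _ lt12); rewrite eq_sym.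
  + by apply: Q1; exact: (binomial_lead eqd neq lt12).
- move=> _ [[m0 _ <-] apm].
  have [m m_deg m_min] := revlex_min_fiber vle_anti vle_trans vle_total a_pt m0.
  pose u := [multinom m (rshift r j) | j < s].
  have mE : m = iotaZ r u.
    apply/mnmP => v; case: (split_ordP v) => [i ->|j ->]; last first.
      by rewrite iotaZ_r mnmE.
    (* If $Y_i$ divided [m], the quotient would have degree [adeg a m0 - a (lshift s i)], against
       the Apéry condition. *)
    rewrite iotaZ_l; apply/eqP; apply: contrapT => /negP; rewrite -lt0n => mi.
    apply: (apm (a (lshift s i))); first by exists i.
    have le_im : (U_(lshift s i) <= m)%MM by rewrite lep1mP -lt0n.
    exists (m - U_(lshift s i))%MM => //.
    by rewrite -m_deg -{2}(submK le_im) adegD adegU addrK.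
  exists u; last by rewrite -mE.
  rewrite /standardZ /= -mE => /monomial_ideal_dvd /(_ m).
  rewrite msuppX mem_seq1 eqxx => /(_ isT)[m1 [f [If _ [m1f m1_max]]] le1].
  have [m2 [m2f neq eqd]] := toric_cancel If m1f.
  have := m1_max _ m2f neq; rewrite agrevlexE // => lt21.
  (* Replacing the factor [m1] of [m] by the smaller [m2] keeps the degree and, by translation
     invariance, gives a monomial below the minimum [m]. *)
  have := m_min (m - m1 + m2)%MM; rewrite -{2 4}(submK le1) revlex_addl lt21.
  by rewrite !adegD eqd => /(_ erefl).
Qed.
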